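(* Let $\mathcal V$ be a Hilbert space, $\mathcal G:\mathcal V\to\mathcal V^*$ a vector field, and let $\mathcal L:\mathcal V\to\mathbb R$ satisfy the strong Lyapunov condition $\mathcal A(c,q,p,\mathcal W)$ with respect to $\mathcal G$: $\mathcal L\geqslant 0$ on $\mathcal W$ and $$-\nabla\mathcal L(x)\cdot\mathcal G(x)\geqslant c(x)\,\mathcal L^q(x)+p^2(x)\qquad\forall\,x\in\mathcal W,$$ with $c>0$ on $\mathcal W$ and a constant $q\geqslant 1$. Let $x(t)$ be a solution of $x'(t)=\mathcal G(x(t))$, $t>0$, such that $\{x(t):t\geqslant t_0\}\subset\mathcal W$ for some $t_0\geqslant 0$. Then for all $t\geqslant t_0$, $$\mathcal L(x(t))\leqslant\begin{cases}\displaystyle \mathcal L(x(t_0))\exp\left(-\int_{t_0}^{t}c(x(s))\,ds\right)&\text{if } q=1,\\[2mm] \displaystyle\left((q-1)\int_{t_0}^{t}c(x(s))\,ds+\mathcal L(x(t_0))^{1-q}\right)^{1/(1-q)}&\text{if } q>1.\end{cases}$$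
   Context: $\mathcal V$ is a real Hilbert space with dual $\mathcal V^*$, which is identified with $\mathcal V$ by the Riesz map; $\nabla\mathcal L(x)\cdot\mathcal G(x)$ denotes the corresponding inner product. $\mathcal W\subseteq\mathcal V$ is a compact subset (local condition), or $\mathcal W=\mathcal V$ (global condition). $\mathcal L$ is continuously differentiable, $c:\mathcal W\to(0,\infty)$ and $p:\mathcal V\to\mathbb R$ are functions. The trajectory $x:[0,\infty)\to\mathcal V$ is continuous on $[0,\infty)$ and continuously differentiable on $(0,\infty)$, and $s\mapsto c(x(s))$ is assumed locally integrable on $[t_0,\infty)$, so that the integrals make sense. When $q>1$ and $\mathcal L(x(t_0))=0$, the right-hand side is interpreted as $0$. *)

(* Defs.v *)
From mathcomp Require Import all_boot all_order all_algebra.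
From mathcomp Require Import all_classical all_reals all_analysis.

Set Implicit Arguments.
Unset Strict Implicit.
Unset Printing Implicit Defensive.

Import Order.TTheory GRing.Theory Num.Theory.
Import numFieldNormedType.Exports.

Local Open Scope classical_set_scope.
Local Open Scope ring_scope.

(* A real Hilbert space is a complete normed module [V] together with an inner
   product [dot : {dot V for idfun}] (bilinear, symmetric, positive definite)
   that induces the norm of [V]. *)
Definition hilbert_product (R : realType) (V : completeNormedModType R)
    (dot : {dot V for idfun}) : Prop :=
  forall u : V, dot u u = `|u| ^+ 2.

(* The Riesz representative of the Frechet derivative ['d L x]; it exists and
   is unique as soon as [L] is differentiable at [x]. *)
Definition gradient (R : realType) (V : completeNormedModType R)
    (dot : {dot V for idfun}) (L : V -> R) (x : V) : V :=
  get [set g : V | forall v : V, 'd L x v = dot g v].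

Definition C1 (R : realType) (V : completeNormedModType R)
    (dot : {dot V for idfun}) (L : V -> R) : Prop :=
  (forall x : V, differentiable L x) /\ continuous (gradient dot L).

(* [G] takes its values in [V], identified with its dual by the Riesz map. *)
Record strong_lyapunov (R : realType) (V : completeNormedModType R)
    (dot : {dot V for idfun}) (G : V -> V) (L : V -> R)
    (c : V -> R) (q : R) (p : V -> R) (W : set V) : Prop := StrongLyapunov {
  lyapunov_domain : compact W \/ W = [set: V] ;
  lyapunov_C1 : C1 dot L ;
  lyapunov_ge0 : forall x, W x -> 0 <= L x ;
  lyapunov_coef_gt0 : forall x, W x -> 0 < c x ;
  lyapunov_exponent_ge1 : 1 <= q ;
  lyapunov_decay : forall x, W x ->
    - dot (gradient dot L x) (G x) >= c x * L x `^ q + p x ^+ 2 }.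

(* Only the values of [x] on [[0, +oo[] matter. *)
Record flow_solution (R : realType) (V : completeNormedModType R)
    (G : V -> V) (x : R -> V) : Prop := FlowSolution {
  flow_continuous : {within `[0, +oo[, continuous x} ;
  flow_derivative : forall t : R, 0 < t -> is_derive t 1 x (G (x t)) ;
  flow_C1 : {within `]0, +oo[, continuous (derive1 x)} }.

(* The library's [locally_integrable] requires an open domain. *)
Definition locally_integrable_from (R : realType) (t0 : R) (f : R -> R) : Prop :=
  forall K : set R, K `<=` `[t0, +oo[ -> compact K ->
    (@lebesgue_measure R).-integrable K (EFin \o f).

(* Main.v *)
Require Import Defs.
From mathcomp Require Import all_boot all_order all_algebra.
From mathcomp Require Import all_classical all_reals all_analysis.
From mathcomp Require Import ring lra.
Import Order.TTheory GRing.Theory Num.Theory.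
Import numFieldNormedType.Exports.
Local Open Scope classical_set_scope.
Local Open Scope ring_scope.

(** Along the flow, [u s = L (x s)] satisfies [u' <= - c u^q], since by Riesz
    [(L \o x)' = <grad L, x'> = <grad L, G>].  Thus [u] is nonincreasing, so if
    [u t = 0] the bound is trivial, and otherwise [u > 0] on [[t0, t]].  Separating
    the variables and integrating from [s > t0], where everything is C^1 up to the
    ends, then letting [s] tend to [t0] (the flow may fail to be differentiable at
    [t0 = 0]), gives [\int c <= Phi (u t) - Phi (u t0)] for any antiderivative [Phi]
    of [- y^(-q)], namely [- ln y] if [q = 1] and [y^(1 - q) / (q - 1)] if
    [q > 1]. *)

(** * Riesz representation in a real Hilbert space *)

Section HilbertProduct.
Context (R : realType) (V : completeNormedModType R).
Context (dot : {dot V for idfun}) (hdot : hilbert_product dot).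

Lemma dotC (u v : V) : dot u v = dot v u.
Proof. by rewrite hermC expr0 mul1r. Qed.

(** Polarization, through which the continuity of [dot] reduces to that of the norm. *)
Lemma dot_polar (u v : V) :
  dot u v = 2^-1 * (`|u + v| ^+ 2 - `|u| ^+ 2 - `|v| ^+ 2).
Proof.
rewrite -!hdot linearDl /= !linearDr /= (dotC v u); lra.
Qed.

Lemma cvg_dot (T : Type) (F : set_system T) (FF : Filter F) (f g : T -> V)
    (a b : V) : f @ F --> a -> g @ F --> b ->
  (dot (f s) (g s)) @[s --> F] --> dot a b.
Proof.
move=> fa gb; rewrite dot_polar.
under eq_fun do rewrite dot_polar.
apply: cvgMr; apply: cvgB; first apply: cvgB; rewrite ?expr2;
  under eq_fun do rewrite expr2; apply: cvgM; apply: cvg_norm => //; exact: cvgD.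
Qed.

(* The representative minimises [v |-> |v|^2 - 2 f v], whose minimising
   filter is Cauchy by the parallelogram identity. *)
Lemma riesz_representation (f : {linear V -> R}) : continuous f ->
  exists g : V, forall v, f v = dot g v.
Proof.
move=> cf.
have [C fC] : exists C : R, forall v, `|f v| <= C * `|v|.
  have /linear_boundedP bf := (linear_bounded_continuous f).2 cf.
  by have [C [_ fC]] := bf; exists (C + 1); apply: fC; rewrite ltrDl.
pose J v : R := `|v| ^+ 2 - 2 * f v.
(* Since [f v <= C * |v|], [J v] is at least [(|v| - C)^2 - C^2]. *)
have Jlb v : - C ^+ 2 <= J v.
  have := fC v; rewrite /J => /ler_normlP[_ h].
  by have := sqr_ge0 (`|v| - C); nra.
have Jpar u v : `|u - v| ^+ 2 = 2 * (J u + J v) - 4 * J (2^-1 *: (u + v)).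
  have fE : f (2^-1 *: (u + v)) = 2^-1 * (f u + f v) by rewrite linearZ linearD.
  rewrite /J fE -!hdot linearZl_LR linearZr_LR /= !linearDl /= !linearDr /=.
  rewrite !linearNl /= !linearNr /= (dotC v u); lra.
have infJ : has_inf (range J).
  by split; [exists (J 0), 0 | exists (- C ^+ 2) => _ [v _ <-]].
pose m := inf (range J).
have mJ v : m <= J v by apply: ge_inf; [exact: infJ.2 | exists v].
pose S e := [set v | J v < m + e].
pose F := filter_from [set e : R | 0 < e] S.
have FF : ProperFilter F.
  apply: filter_from_proper; last first.
    move=> e e0; have [_ [v _ <-] ve] := inf_adherent e0 infJ.
    by exists v.
  apply: filter_from_filter; first by exists 1; rewrite /= ltr01.
  move=> d e /= d0 e0; exists (Num.min d e); first by rewrite /= lt_min d0.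
  by move=> v; rewrite /S /= -ltrBlDl lt_min !ltrBlDl => /andP[].
have Fc : cauchy F.
  apply: cauchy_exP => e e0.
  (* If [J u] and [J v] are below [m + e^2 / 4], then, as [J] is at least [m] at the midpoint,
     [Jpar] gives [|u - v|^2 < e^2]. *)
  have d0 : 0 < e ^+ 2 / 4 by rewrite divr_gt0 ?exprn_gt0.
  have [_ [u _ <-] ue] := inf_adherent d0 infJ.
  exists u, (e ^+ 2 / 4) => //= v; rewrite /S /= => ve.
  rewrite -ball_normE /= -(@ltr_pXn2r _ 2) ?nnegrE ?normr_ge0 ?(ltW e0) //.
  by rewrite Jpar; have := mJ (2^-1 *: (u + v)); rewrite -/m in ue *; lra.
have Fl : cvg F by exact: cauchy_cvg.
have /cvg_ex[g Fg] := Fl.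
have Jg : J v @[v --> F] --> J g.
  apply: cvgB.
    under eq_fun do rewrite expr2; rewrite expr2.
    by apply: cvgM; apply: cvg_norm.
  by apply: cvgMr; apply: cvg_comp; [exact: Fg | exact: cf].
have Jgm : J g <= m.
  apply/ler_addgt0Pl => e e0; rewrite addrC.
  apply: (cvgr_to_le Jg).
  by exists e => // v; exact: ltW.
exists g => v.
(* First variation: the minimum of [J] at [g], tested on the line through [g] directed by [v]. *)
have key t : 0 <= t ^+ 2 * `|v| ^+ 2 + 2 * t * (dot g v - f v).
  have : J g <= J (g + t *: v) := le_trans Jgm (mJ _).
  have fE : f (g + t *: v) = f g + t * f v by rewrite linearD linearZ.
  have dE : dot (g + t *: v) (g + t *: v) =
      dot g g + 2 * t * dot g v + t ^+ 2 * dot v v.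
    by rewrite hnormD linearZl_LR !linearZr_LR /= expr0 /GRing.scale /=; ring.
  by rewrite /J fE -!hdot dE; lra.
set n := `|v| ^+ 2 in key; set d := dot g v - f v in key.
have n0 : 0 <= n by exact: sqr_ge0.
apply/esym/eqP; rewrite -subr_eq0 -/d; apply/eqP.
(* The quadratic is minimal at [t = - d / n]; the denominator [n + 1] also covers [v = 0] and still
   leaves a negative multiple of [d^2]. *)
have := key (- d / (n + 1)); have n1 : n + 1 != 0 by lra.
have -> : (- d / (n + 1)) ^+ 2 * n + 2 * (- d / (n + 1)) * d =
    - (d ^+ 2 * ((n + 2) / (n + 1) ^+ 2)) by field.
rewrite oppr_ge0 pmulr_lle0 => [d2|].
  by apply/eqP; rewrite -sqrf_eq0 eq_le d2 sqr_ge0.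
by rewrite divr_gt0 ?exprn_gt0 //; lra.
Qed.

End HilbertProduct.

(** Riesz makes the set in [gradient] nonempty, so [get] returns one of its members rather than a
    default value. *)
Lemma gradientE (R : realType) (V : completeNormedModType R)
    (dot : {dot V for idfun}) (hdot : hilbert_product dot) (L : V -> R) (x v : V) :
  differentiable L x -> 'd L x v = dot (gradient dot L x) v.
Proof.
move=> dL; rewrite /gradient.
have [g gE] := riesz_representation _ _ _ hdot _ (diff_continuous dL).
by case: xgetP => [_ -> ->//|/(_ g)/(_ gE)].
Qed.

(** * Integral inequalities for functions differentiable away from the left endpoint *)

Lemma integral_le_increment (R : realType) (w dw c : R -> R) (a b : R) :
    a <= b -> (@lebesgue_measure R).-integrable `[a, b] (EFin \o c) ->
    w s @[s --> a^'+] --> w a ->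
    (forall s, s \in `]a, b] -> is_derive s 1 w (dw s)) ->
    (forall s, s \in `]a, b] -> {for s, continuous dw}) ->
    (forall s, s \in `]a, b] -> c s <= dw s) ->
  \int[@lebesgue_measure R]_(s in `[a, b]) c s <= w b - w a.
Proof.
rewrite le_eqVlt => /predU1P[<- *|ab ic wa w_dw cdw c_dw].
  by rewrite set_itv1 Rintegral_set1 subrr.
pose mu := @lebesgue_measure R.
have inner s : a < s < b -> \int[mu]_(r in `[s, b]) c r <= w b - w s.
  move=> /andP[as_ sb].
  have sub r : r \in `[s, b] -> r \in `]a, b].
    by rewrite !in_itv /= => /andP[sr ->]; rewrite (lt_le_trans as_ sr).
  have cdws : {within `[s, b], continuous dw}.
    by apply: continuous_subspace_itv => r /sub; exact: cdw.
  have wD r : r \in `[s, b] -> derivable w r 1.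
    by move=> /sub/w_dw[].
  have wc r : r \in `[s, b] -> {for r, continuous w}.
    move=> /wD/derivable1_diffP; exact: differentiable_continuous.
  have FTC : \int[mu]_(r in `[s, b]) dw r = w b - w s.
    rewrite /Rintegral (continuous_FTC2 (F := w) sb cdws) //.
      split=> [r rsb||].
      - exact/wD/subset_itv_oo_cc.
      - by apply/cvg_at_right_filter/wc; rewrite in_itv /= lexx ltW.
      - by apply/cvg_at_left_filter/wc; rewrite in_itv /= lexx ltW.
    move=> r rsb; rewrite derive1E.
    by have /sub/w_dw[] := subset_itv_oo_cc rsb.
  rewrite -FTC; apply: le_Rintegral => //.
  - apply: integrableS ic => //.
    by apply: subset_itvr; rewrite bnd_simp ltW.
  - exact/continuous_compact_integrable/cdws/segment_compact.
  - by move=> r /= /sub; exact: c_dw.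
(* Split the integral at [s]: the piece over [[a, s]] vanishes in the limit by integrability of [c],
   and [inner] bounds the other piece. *)
have lim0 : \int[mu]_(r in `[a, s]) c r + (w b - w s) @[s --> a^'+]
    --> 0 + (w b - w a).
  apply: cvgD; last exact: cvgB (cvg_cst _) wa.
  exact/cvg_at_right_filter/parameterized_integral_cvg_left/ic.
rewrite -[leRHS]add0r; apply: (cvgr_to_ge lim0).
near=> s.
have asb : a < s < b by apply/andP; split => //.
move/andP: (asb) => [as_ sb].
rewrite -lerBlDl (@Rintegral_itvB _ _ _ (BRight b)) ?bnd_simp ?(ltW as_)
  ?(ltW sb) //.
rewrite Rintegral_itv_obnd_cbnd ?inner //.
by apply: integrableS ic => //; apply: subset_itvr; rewrite bnd_simp ltW.
Unshelve. all: end_near.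
Qed.

Lemma is_derive_comp_diff (R : realType) (V : normedModType R) (L : V -> R)
    (x : R -> V) (s : R) (v : V) :
  is_derive s 1 x v -> differentiable L (x s) ->
  is_derive s 1 (L \o x) ('d L (x s) v).
Proof.
move=> [/derivable1_diffP dx xv] dL.
have dLx : differentiable (L \o x) s by exact: differentiable_comp.
apply: DeriveDef; first exact/derivable1_diffP.
by rewrite deriveE // diff_comp //= -xv deriveE.
Qed.

(* [Phi \o u] has derivative [- u^(-q) u'], which dominates [c]. *)
Lemma separation_of_variables (R : realType) (q : R) (Phi u du c : R -> R)
    (a b : R) :
    (forall y : R, 0 < y -> is_derive y 1 Phi (- y `^ (- q))) ->
    a <= b -> (@lebesgue_measure R).-integrable `[a, b] (EFin \o c) ->
    (forall s, s \in `[a, b] -> 0 < u s) ->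
    u s @[s --> a^'+] --> u a ->
    (forall s, s \in `]a, b] -> is_derive s 1 u (du s)) ->
    (forall s, s \in `]a, b] -> {for s, continuous du}) ->
    (forall s, s \in `]a, b] -> du s <= - (c s * u s `^ q)) ->
  \int[@lebesgue_measure R]_(s in `[a, b]) c s <= Phi (u b) - Phi (u a).
Proof.
move=> dPhi ab ic u0 ua u_du cdu decay.
have sub s : s \in `]a, b] -> s \in `[a, b] by exact: subset_itv_oc_cc.
apply: (@integral_le_increment R (Phi \o u) (fun s => - u s `^ (- q) * du s)) => //.
- apply: continuous_cvg ua => //=.
  apply: (differentiable_continuous (f := Phi)); apply/derivable1_diffP.
  have ua0 : 0 < u a by apply: u0; rewrite in_itv /= lexx.
  by have [] := dPhi _ ua0.
- move=> s sab; apply: is_derive1_comp; last exact: u_du.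
  exact/dPhi/u0/sub.
- move=> s sab; apply: cvgM; last exact: cdu.
  apply: cvgN; apply: (continuous_comp (f := u) (g := fun y => y `^ (- q))).
    apply: differentiable_continuous; apply/derivable1_diffP.
    by have [] := u_du _ sab.
  apply: differentiable_continuous; apply/derivable1_diffP.
  by have [] := is_derive1_powR (- q) (u0 _ (sub _ sab)).
- move=> s sab; have us0 := u0 _ (sub _ sab).
  rewrite powRN mulNr -mulrN mulrC ler_pdivlMr ?powR_gt0 // lerNr.
  exact: decay.
Qed.

(** * Decay of [L] along the flow *)

Theorem theorem3p1 (R : realType) (V : completeNormedModType R)
    (dot : {dot V for idfun}) (hdot : hilbert_product dot)
    (G : V -> V) (L : V -> R) (c : V -> R) (q : R) (p : V -> R) (W : set V)
    (hL : strong_lyapunov dot G L c q p W)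
    (x : R -> V) (hx : flow_solution G x)
    (t0 : R) (ht0 : 0 <= t0) (hW : forall t, t0 <= t -> W (x t))
    (hc : locally_integrable_from t0 (c \o x)) :
  forall t : R, t0 <= t ->
    (q = 1 ->
       L (x t) <= L (x t0) *
         expR (- \int[@lebesgue_measure R]_(s in `[t0, t]) c (x s))) /\
    (1 < q ->
       L (x t) <=
         if L (x t0) == 0 then 0
         else ((q - 1) * (\int[@lebesgue_measure R]_(s in `[t0, t]) c (x s)) +
               L (x t0) `^ (1 - q)) `^ (1 / (1 - q))).
Proof.
move=> t t0t.
have [_ [dL cgrad] L0 c0 q1 decay] := hL.
have [cx dx cdx] := hx.
(* With [derive1 x s] in place of [G (x s)], the continuity of [du] follows from that of [x']; no
   continuity is assumed of [G]. *)
pose u s := L (x s); pose du s := dot (gradient dot L (x s)) (derive1 x s).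
have pos s : t0 < s -> 0 < s by exact: le_lt_trans.
have x'E (s : R) : 0 < s -> derive1 x s = G (x s).
  by move=> /dx[_]; rewrite derive1E.
have cx0 (s : R) : 0 < s -> {for s, continuous x}.
  by move=> /dx[/derivable1_diffP xs _]; exact: differentiable_continuous.
have cL y : {for y, continuous L} by exact: differentiable_continuous.
have cxt0 : {within `[t0, +oo[, continuous x}.
  by apply: continuous_subspaceW cx; apply: subset_itvr; rewrite bnd_simp.
have u_t0 : u s @[s --> t0^'+] --> u t0.
  have [_ xt0] := (continuous_within_itvcyP _ _).1 cxt0.
  exact: (continuous_cvg _ (cL (x t0)) xt0).
have u_du (s : R) : 0 < s -> is_derive s 1 u (du s).
  move=> s0; rewrite /du x'E // -(gradientE _ _ _ hdot) //.
  by apply: is_derive_comp_diff => //; exact: dx.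
have cdu (s : R) : 0 < s -> {for s, continuous du}.
  move=> s0; apply: cvg_dot => //.
    by apply: (continuous_comp (f := x)); [exact: cx0|exact: cgrad].
  move: cdx; rewrite continuous_open_subspace // => /(_ s); apply.
  by rewrite inE /= in_itv /= s0.
have decay_u s : t0 < s -> du s <= - (c (x s) * u s `^ q).
  move=> ts; rewrite /du x'E ?pos // lerNr.
  by apply: le_trans (decay _ (hW _ (ltW ts))); rewrite lerDl sqr_ge0.
have u_ge0 s : t0 <= s -> 0 <= u s by move=> /hW/L0.
have cu : {within `[t0, +oo[, continuous u}.
  apply/continuous_within_itvcyP; split => // s.
  rewrite in_itv /= andbT => /pos/u_du[/derivable1_diffP us _].
  exact: differentiable_continuous.
have u_decr r s : t0 <= r -> r <= s -> u s <= u r.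
  apply: ler0_derive1_nincry cu _ _ => y; rewrite in_itv /= andbT => ty.
    by have [] := u_du _ (pos _ ty).
  have [_] := u_du _ (pos _ ty); rewrite -derive1E => ->.
  apply: le_trans (decay_u _ ty) _.
  by rewrite oppr_le0 mulr_ge0 ?powR_ge0 //; apply/ltW/c0/hW/ltW.
have ic : (@lebesgue_measure R).-integrable `[t0, t] (EFin \o (c \o x)).
  by apply: hc; [apply: subset_itvl|exact: segment_compact].
set I := \int[_]_(s in _) _.
have I0 : 0 <= I.
  apply: Rintegral_ge0 => s /=; rewrite in_itv /= => /andP[ts _].
  exact/ltW/c0/hW.
have sep (Phi : R -> R) : 0 < u t ->
    (forall y : R, 0 < y -> is_derive y 1 Phi (- y `^ (- q))) ->
    I <= Phi (u t) - Phi (u t0).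
  move=> ut0 dPhi.
  have sub s : s \in `]t0, t] -> t0 < s by rewrite in_itv => /andP[].
  apply: (@separation_of_variables R q Phi u du (c \o x)) => //.
  - move=> s; rewrite in_itv /= => /andP[ts st].
    exact: lt_le_trans ut0 (u_decr _ _ ts st).
  - by move=> s /sub/pos/u_du.
  - by move=> s /sub/pos/cdu.
  - by move=> s /sub/decay_u.
rewrite -![L (x _)]/(u _).
(* If [u t = 0], it suffices that each right-hand side is nonnegative, including both branches of
   the conditional. *)
have := u_ge0 _ t0t; rewrite le_eqVlt => /predU1P[<-|ut0].
  split=> _; first by rewrite mulr_ge0 ?expR_ge0 ?u_ge0.
  by case: ifP => _; rewrite ?powR_ge0.
have u0 : 0 < u t0 by exact: lt_le_trans ut0 (u_decr _ _ (lexx _) t0t).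
split=> [q_eq|q_gt].
  have dPhi (y : R) : 0 < y ->
      is_derive y 1 (fun r : R => - ln r) (- y `^ (- q)).
    move=> y0; rewrite q_eq powR_inv1 ?(ltW y0) //.
    exact: is_deriveN (is_derive1_ln y0).
  have := sep _ ut0 dPhi; rewrite opprK => le_I.
  rewrite -[u t]lnK ?posrE // -[u t0 in leRHS]lnK ?posrE // -expRD ler_expR.
  by lra.
(* Since [u t0 > 0], the conditional selects the power formula. *)
rewrite gt_eqF //.
have dPhi (y : R) : 0 < y ->
    is_derive y 1 (fun r : R => (q - 1)^-1 * r `^ (1 - q)) (- y `^ (- q)).
  move=> y0.
  have -> : - y `^ (- q) = (q - 1)^-1 *: ((1 - q) * y `^ (1 - q - 1)).
    rewrite (_ : 1 - q - 1 = - q); last by ring.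
    by rewrite /GRing.scale /=; field; lra.
  exact: (is_deriveZ (q - 1)^-1 (is_derive1_powR (1 - q) y0)).
have := sep _ ut0 dPhi; rewrite -mulrBr mulrC ler_pdivlMr ?subr_gt0 // => le_I.
set A := _ + _.
have A0 : 0 < A by rewrite ltr_wpDl ?powR_gt0 // mulr_ge0 // subr_ge0.
have A_le : A <= u t `^ (1 - q) by rewrite /A mulrC -lerBrDr.
have -> : u t = (u t `^ (1 - q)) `^ (1 / (1 - q)).
  by rewrite -powRrM mulrC divfK ?powRr1 ?ltW //; lra.
(* The exponent is negative, so the power reverses [A_le]: pass to inverses and use monotonicity for
   the positive exponent [1 / (q - 1)]. *)
have -> : 1 / (1 - q) = - (1 / (q - 1)) by field; lra.
rewrite !powRN lef_pV2 ?posrE ?powR_gt0 //.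
by apply: ge0_ler_powR; rewrite ?nnegrE ?powR_ge0 ?(ltW A0) // divr_ge0 // subr_ge0.
Qed.
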